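(* Let $k$ be a nonnegative integer. For every integer $g$ with $0 \le g \le k$, the games $T_k$ and $W_1$ have the same set of positions with nim-value $g$. In particular, if $k$ and $l$ are nonnegative integers, then for every integer $g$ with $0 \le g \le \min(k,l)$, the games $T_k$ and $T_l$ have the same set of positions with nim-value $g$.
   Context: Positions are pairs $(a,b)$ of nonnegative integers; games are impartial with normal play (the last player able to move wins). In the game $W_1$, from $(a,b)$ one may make a Nim move to $(a-s,b)$ or $(a,b-s)$ for any integer $s>0$ keeping coordinates nonnegative, or a diagonal move to $(a-s,b-s)$ with $s>0$ provided $\min(a-s,b-s) \ge 1$. For an integer $k \ge 0$, the game $T_k$ allows all the same Nim moves, and restricts the diagonal moves of $W_1$ as follows: if $a \le b$, a diagonal move from $(a,b)$ to $(a-s,b-s)$ with $s>0$ and $a-s>0$ is allowed if and only if $\left| \left\lfloor \frac{b-s}{a-s} \right\rfloor - \left\lfloor \frac{b}{a} \right\rfloor \right| \le k$; symmetrically, if $a > b$, a diagonal move to $(a-s,b-s)$ with $b-s>0$ is allowed if and only if $\left| \left\lfloor \frac{a-s}{b-s} \right\rfloor - \left\lfloor \frac{a}{b} \right\rfloor \right| \le k$. The nim-value (Sprague–Grundy value) of a position is the minimum excluded nonnegative integer of the set of nim-values of positions reachable in one move (terminal positions have nim-value $0$). *)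

(* Defs.v *)
From mathcomp Require Import all_boot all_order ssralg ssrint zify.

Set Implicit Arguments.
Unset Strict Implicit.
Unset Printing Implicit Defensive.

Import IntDist.

Definition position := (nat * nat)%type.

(* An impartial game is given by the list of options of each position. *)
Definition game := position -> seq position.

(* The minimum excluded value is at most [size s], hence the search bound. *)
Definition mex (s : seq nat) : nat :=
  find (fun n => n \notin s) (iota 0 (size s).+1).

Fixpoint nim_value_rec (G : game) (fuel : nat) (p : position) : nat :=
  if fuel is n.+1 then mex [seq nim_value_rec G n q | q <- G p] else 0.

(* The fuel suffices whenever every move strictly decreases the sum of the
   coordinates; see [nim_valueE]. *)
Definition nim_value (G : game) (p : position) : nat :=
  nim_value_rec G (p.1 + p.2).+1 p.

Definition nim_positions (G : game) (g : nat) : pred position :=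
  [pred p | nim_value G p == g].

Definition nim_moves (a b : nat) : seq position :=
  [seq (a - s, b) | s <- iota 1 a] ++ [seq (a, b - s) | s <- iota 1 b].

(* The range [1 <= s <= minn a b] keeps both truncated subtractions exact. *)
Definition diag_moves (ok : nat -> bool) (a b : nat) : seq position :=
  [seq (a - s, b - s) | s <- iota 1 (minn a b) & ok s].

Definition W1 : game := fun p =>
  let: (a, b) := p in
  nim_moves a b ++ diag_moves (fun s => 1 <= minn (a - s) (b - s)) a b.

(* Inside [`| _ - _ |] the outer difference is the integer one, not the truncated
   one. *)
Definition T (k : nat) : game := fun p =>
  let: (a, b) := p in
  nim_moves a b ++
  diag_moves (fun s =>
    if a <= b then
      (0 < a - s) && (`|(b - s) %/ (a - s) - b %/ a| <= k)
    else
      (0 < b - s) && (`|(a - s) %/ (b - s) - a %/ b| <= k)) a b.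

Lemma mex_exists (s : seq nat) :
  has (fun n => n \notin s) (iota 0 (size s).+1).
Proof.
apply/negPn/negP; rewrite -all_predC => /allP h.
have /(uniq_leq_size (iota_uniq 0 _)) : {subset iota 0 (size s).+1 <= s}.
  by move=> n /h /=; rewrite negbK.
by rewrite size_iota ltnn.
Qed.

Lemma mex_notin (s : seq nat) : mex s \notin s.
Proof.
have h := mex_exists s; have := nth_find 0 h.
by rewrite nth_iota // -[X in _ < X](size_iota 0) -has_find.
Qed.

Lemma mex_min (s : seq nat) (n : nat) : n < mex s -> n \in s.
Proof.
move=> h; have := before_find 0 h; rewrite nth_iota; first by move/negbFE.
by apply: (leq_trans h); rewrite -[X in _ <= X](size_iota 0) find_size.
Qed.

Definition sum_decreasing (G : game) : Prop :=
  forall p q, q \in G p -> q.1 + q.2 < p.1 + p.2.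

Lemma nim_value_rec_fuel (G : game) (p : position) (n : nat) :
  sum_decreasing G -> p.1 + p.2 < n -> nim_value_rec G n p = nim_value G p.
Proof.
move=> dec; rewrite /nim_value.
suff H m : forall n' q, q.1 + q.2 < m -> q.1 + q.2 < n' ->
    nim_value_rec G n' q = nim_value_rec G m q by move=> h; apply: H.
elim: m => [|m IH] [|n'] q //= hm hn; congr mex; apply/eq_in_map => r /dec hr.
by apply: IH; [exact: leq_trans hr hm | exact: leq_trans hr hn].
Qed.

Lemma nim_valueE (G : game) (p : position) :
  sum_decreasing G -> nim_value G p = mex [seq nim_value G q | q <- G p].
Proof.
move=> dec; rewrite {1}/nim_value /=; congr mex; apply/eq_in_map => q /dec hq.
exact: nim_value_rec_fuel.
Qed.

Lemma nim_diag_decreasing (ok : nat -> bool) (a b : nat) (q : position) :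
  q \in nim_moves a b ++ diag_moves ok a b -> q.1 + q.2 < a + b.
Proof.
rewrite !mem_cat => /orP[/orP[]|] /mapP[s];
  rewrite ?mem_filter mem_iota => hs -> /=; lia.
Qed.

Lemma W1_decreasing : sum_decreasing W1.
Proof. by move=> [a b] q /nim_diag_decreasing. Qed.

Lemma T_decreasing (k : nat) : sum_decreasing (T k).
Proof. by move=> [a b] q /nim_diag_decreasing. Qed.

(* Main.v *)
Require Import Defs.
From mathcomp Require Import all_boot.
From mathcomp Require Import ssralg ssrint zify.

Set Implicit Arguments.
Unset Strict Implicit.
Unset Printing Implicit Defensive.

Import IntDist.

(** In row [c > 0] of [W1], the position of nim-value [g] lies in a column
    [d <= 2c - 1 + g]: each earlier position of the row either has a value below
    [g] or moves to a position of value [g] in one of the [c] lower rows; each such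
    position is hit by at most one vertical and one diagonal move from row [c], and
    row [0] by no diagonal one.  Hence if [c <= d] and [g <= k], then
    [d %/ c <= k + 1].  A diagonal move away from the axes can only increase the
    quotient, which is at least [1] to begin with, so [T k] keeps every move of
    [W1] to a position of value at most [k].  The two games therefore agree, by
    induction, on which positions have value [g <= k]. *)

Lemma nim_value_option (G : game) (p q : position) :
  sum_decreasing G -> q \in G p -> nim_value G q <> nim_value G p.
Proof.
move=> dec qp; rewrite (nim_valueE p dec) => e.
by have /negP := mex_notin [seq nim_value G r | r <- G p];
  rewrite -e; apply; apply: map_f.
Qed.

Lemma nim_value_lt_option (G : game) (p : position) (h : nat) :
  sum_decreasing G -> h < nim_value G p ->
  exists2 q, q \in G p & nim_value G q = h.
Proof.
by move=> dec; rewrite nim_valueE // => /mex_min /mapP[q qp ->]; exists q.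
Qed.

(** Only options of value at most [g] enter the two conditions, so a value can be carried over
    between games that agree just on small values. *)
Lemma nim_value_eq (G : game) (p : position) (g : nat) :
  sum_decreasing G ->
  (forall q, q \in G p -> nim_value G q <> g) ->
  (forall h, h < g -> exists2 q, q \in G p & nim_value G q = h) ->
  nim_value G p = g.
Proof.
move=> dec ne lt; have [h|h|//] := ltngtP (nim_value G p) g.
- by have [q qp] := lt _ h; move/(nim_value_option dec qp).
- by have [q qp] := nim_value_lt_option dec h; move/ne: qp.
Qed.

Lemma nim_movesP (a b : nat) (q : position) :
  reflect ((q.1 < a /\ q.2 = b) \/ (q.1 = a /\ q.2 < b)) (q \in nim_moves a b).
Proof.
case: q => c d; rewrite mem_cat.
apply: (iffP orP) => /= -[].
- by case/mapP=> s; rewrite mem_iota => hs [-> ->]; lia.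
- by case/mapP=> s; rewrite mem_iota => hs [-> ->]; lia.
- move=> [h ->]; left; apply/mapP; exists (a - c); first by rewrite mem_iota; lia.
  by congr pair; lia.
- move=> [-> h]; right; apply/mapP; exists (b - d); first by rewrite mem_iota; lia.
  by congr pair; lia.
Qed.

Lemma diag_movesP (ok : nat -> bool) (a b : nat) (q : position) :
  reflect (exists2 s, 0 < s /\ ok s & a = q.1 + s /\ b = q.2 + s)
          (q \in diag_moves ok a b).
Proof.
case: q => c d; apply: (iffP mapP) => /= -[s].
- by rewrite mem_filter mem_iota => /andP[oks hs] [-> ->]; exists s; lia.
- move=> [s0 oks] [ha hb]; exists s; last by congr pair; lia.
  by rewrite mem_filter oks mem_iota; lia.
Qed.

Lemma W1P (a b : nat) (q : position) :
  reflect ((q.1 < a /\ q.2 = b) \/ (q.1 = a /\ q.2 < b) \/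
           (exists2 s, 0 < s & [/\ a = q.1 + s, b = q.2 + s, 0 < q.1 & 0 < q.2]))
          (q \in W1 (a, b)).
Proof.
rewrite mem_cat; apply: (iffP orP).
- case=> [/nim_movesP|/diag_movesP[s [s0 ok] [ha hb]]]; first by tauto.
  by right; right; exists s => //; split=> //; lia.
- case=> [h|[h|[s s0 [ha hb h1 h2]]]]; [left|left|right].
  + by apply/nim_movesP; left.
  + by apply/nim_movesP; right.
  + by apply/diag_movesP; exists s; split=> //; lia.
Qed.

Lemma W1_swap (a b c d : nat) : (c, d) \in W1 (a, b) -> (d, c) \in W1 (b, a).
Proof.
case/W1P=> /= [[h1 h2]|[[h1 h2]|[s s0 [ha hb h1 h2]]]]; apply/W1P => /=.
- by right; left.
- by left.
- by right; right; exists s.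
Qed.

Lemma nim_value_W1_swap (a b : nat) : nim_value W1 (a, b) = nim_value W1 (b, a).
Proof.
have [n le_n] := ubnP (a + b); elim: n => // n IH in a b le_n *.
have IHo c d : (c, d) \in W1 (b, a) -> nim_value W1 (d, c) = nim_value W1 (c, d).
  by move=> /W1_decreasing /= h; apply: IH; lia.
apply: (nim_value_eq W1_decreasing) => [[c d] /W1_swap h|h].
- by rewrite IHo //; apply: nim_value_option W1_decreasing _.
- move/(nim_value_lt_option W1_decreasing) => [[c d] cd <-].
  by exists (d, c); [exact: W1_swap | exact: IHo].
Qed.

Lemma nim_value_W1_row_inj (c : nat) : injective (fun d => nim_value W1 (c, d)).
Proof.
have lt d e : d < e -> nim_value W1 (c, d) <> nim_value W1 (c, e).
  move=> de; apply: (nim_value_option W1_decreasing).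
  by apply/W1P; right; left.
by move=> d e /=; have [/lt|/lt h /esym|//] := ltngtP d e.
Qed.

(** A relation lets codes be described by how they are decoded. The injection [f] picks the least
    code of [x], and a code shared by [x] and [x'] forces [x = x']. *)
Lemma rel_pigeonhole (R : rel nat) (m n : nat) :
  (forall x, x < m -> exists2 y, y < n & R x y) ->
  (forall x x' y, x < m -> x' < m -> R x y -> R x' y -> x = x') -> m <= n.
Proof.
move=> tot inj; pose f x := find (R x) (iota 0 n).
have hasR x : x < m -> has (R x) (iota 0 n).
  by move/tot=> [y yn Rxy]; apply/hasP; exists y; rewrite ?mem_iota.
have f_lt x : x < m -> f x < n.
  by move=> xm; have := hasR _ xm; rewrite has_find size_iota.
have Rf x : x < m -> R x (f x).
  move=> xm; have := nth_find 0 (hasR _ xm).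
  by rewrite nth_iota //; apply: f_lt.
rewrite -(size_iota 0 m) -(size_map f) -(size_iota 0 n).
apply: uniq_leq_size.
- rewrite map_inj_in_uniq ?iota_uniq // => x x'.
  rewrite !mem_iota /= => xm x'm e.
  by apply: (inj _ _ (f x)); rewrite ?Rf // e Rf.
- by move=> _ /mapP[x + ->]; rewrite !mem_iota; apply: f_lt.
Qed.

Lemma nim_value_W1_row_bound (c d : nat) :
  0 < c -> d <= nim_value W1 (c, d) + c + c.-1.
Proof.
move=> c0; set g := nim_value W1 (c, d).
(* Codes below [g] record a small value, the next [c] codes the row of a vertical
   move to value [g], and the last [c - 1] codes that of a diagonal one. *)
pose R e y :=
  if y < g then nim_value W1 (c, e) == y
  else if y < g + c then nim_value W1 (y - g, e) == g
  else let r := (y - g - c).+1 in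
       (c - r <= e) && (nim_value W1 (r, e - (c - r)) == g).
apply: (@rel_pigeonhole R) => [e ed|e e' y _ _]; last first.
  rewrite /R; case: ifP => _ /=; last case: ifP => _.
  - by move=> /eqP v /eqP v'; apply: (@nim_value_W1_row_inj c); rewrite v v'.
  - by move=> /eqP v /eqP v'; apply: (@nim_value_W1_row_inj (y - g)); rewrite v v'.
  (* The guards make both truncated subtractions exact, so equal columns in the lower row give
     [e = e']. *)
  - case/andP=> le /eqP v /andP[le']; rewrite -[X in _ == X]v => /eqP.
    by move/nim_value_W1_row_inj; lia.
have [lt|lt|eq] := ltngtP (nim_value W1 (c, e)) g.
- by exists (nim_value W1 (c, e)); [lia | rewrite /R lt].
- have [[r x] /W1P /=] := nim_value_lt_option W1_decreasing lt.
  case=> [[rc ->]|[[-> xe]|[s s0 [hc he r0 x0]]]] v.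
  + exists (g + r); first lia.
    rewrite /R ifN; last lia.
    rewrite ifT; last lia.
    by rewrite addKn v.
  (* Row injectivity would give [x = d], whereas [x < e < d]. *)
  + by have := @nim_value_W1_row_inj c _ _ v; lia.
  (* A diagonal move ends in a row [r] with [0 < r < c], so [r.-1] takes only [c - 1] values. *)
  + exists (g + c + r.-1); first lia.
    rewrite /R ifN; last lia.
    rewrite ifN; last lia.
    have -> : (g + c + r.-1 - g - c).+1 = r by lia.
    have -> : e - (c - r) = x by lia.
    by rewrite v eqxx andbT; lia.
- by have := @nim_value_W1_row_inj c _ _ eq; lia.
Qed.

(** The row bound gives [d <= k + 2c - 1 < (k + 2)c], as [k <= kc]. *)
Lemma divn_W1_bound (c d k : nat) :
  0 < c -> nim_value W1 (c, d) <= k -> d %/ c <= k.+1.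
Proof.
move=> c0 le_k; rewrite -ltnS ltn_divLR //.
by have := nim_value_W1_row_bound d c0; nia.
Qed.

(** The quotient [q] on the left is at least 1, so [q(c + s) <= d + s] yields
    [qc <= d - (q - 1)s <= d]. *)
Lemma leq_divn_diag (c d s : nat) :
  0 < c -> c <= d -> (d + s) %/ (c + s) <= d %/ c.
Proof.
move=> c0 cd; rewrite leq_divRL //.
have := leq_trunc_div (d + s) (c + s).
have : 0 < (d + s) %/ (c + s) by rewrite divn_gt0; lia.
by move: (_ %/ _) => q; nia.
Qed.

Lemma ratio_change_small (c d s k : nat) :
  0 < c -> c <= d -> nim_value W1 (c, d) <= k ->
  `|d %/ c - (d + s) %/ (c + s)| <= k.
Proof.
move=> c0 cd le_k; rewrite distnEl ?leq_divn_diag //.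
have := divn_W1_bound c0 le_k.
have : 0 < (d + s) %/ (c + s) by rewrite divn_gt0; lia.
lia.
Qed.

Lemma T_sub_W1 (k : nat) (p : position) : {subset T k p <= W1 p}.
Proof.
case: p => a b q; rewrite mem_cat => /orP[qp|/diag_movesP[s [s0 ok] [ha hb]]].
  by rewrite mem_cat qp.
apply/W1P; right; right; exists s => //.
by move: ok; case: ifP => ? /andP[h _]; split=> //; lia.
Qed.

Lemma T_of_W1 (k : nat) (p q : position) :
  q \in W1 p -> nim_value W1 q <= k -> q \in T k p.
Proof.
case: p q => a b [c d] /W1P /=.
case=> [h|[h|[s s0 [-> -> c0 d0]]]] le_k; rewrite mem_cat.
- by apply/orP; left; apply/nim_movesP; left.
- by apply/orP; left; apply/nim_movesP; right.
apply/orP; right; apply/diag_movesP; exists s => //; split=> //.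
rewrite !addnK leq_add2r; case: ifP => cd; apply/andP; split=> //.
- exact: ratio_change_small.
(* Here [d < c], and reflecting the position in the diagonal keeps its value. *)
- by apply: ratio_change_small; rewrite 1?nim_value_W1_swap //; lia.
Qed.

Lemma nim_value_T_W1 (k : nat) (p : position) (g : nat) :
  g <= k -> (nim_value (T k) p == g) = (nim_value W1 p == g).
Proof.
have [n le_n] := ubnP (p.1 + p.2); elim: n => // n IH in p g le_n *.
move=> gk.
have IHW q h : q \in W1 p -> h <= k ->
    (nim_value (T k) q == h) = (nim_value W1 q == h).
  by move=> /W1_decreasing lt hk; apply: IH hk; apply: leq_trans lt le_n.
apply/eqP/eqP => vp.
- apply: (nim_value_eq W1_decreasing) => [q qp vq|h hg].
  (* A [W1] option of value [g <= k] survives in [T k], where by induction it again has value [g],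
     the value of [p] itself. *)
  + have qT : q \in T k p by apply: T_of_W1; rewrite ?vq.
    apply: (nim_value_option (T_decreasing (k := k)) qT).
    by rewrite vp; apply/eqP; rewrite IHW // vq.
  + rewrite -vp in hg.
    have [q /T_sub_W1 qp vq] := nim_value_lt_option (T_decreasing (k := k)) hg.
    by exists q => //; apply/eqP; rewrite -IHW ?vq //; lia.
- apply: (nim_value_eq (T_decreasing (k := k))) => [q /T_sub_W1 qp vq|h hg].
  + apply: (nim_value_option W1_decreasing qp).
    by rewrite vp; apply/eqP; rewrite -IHW // vq.
  + rewrite -vp in hg.
    have [q qp vq] := nim_value_lt_option W1_decreasing hg.
    exists q; first by apply: T_of_W1 => //; lia.
    by apply/eqP; rewrite IHW ?vq //; lia.
Qed.

Theorem theorem8 (k : nat) :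
  (forall g : nat, g <= k -> nim_positions (T k) g =i nim_positions W1 g) /\
  (forall l g : nat, g <= minn k l ->
    nim_positions (T k) g =i nim_positions (T l) g).
Proof.
split=> [g gk p|l g]; first by rewrite !inE nim_value_T_W1.
by rewrite leq_min => /andP[gk gl] p; rewrite !inE !nim_value_T_W1.
Qed.
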